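(* For each positive integer $k$ there is a bipartite graph $G_k$ such that $p(G_k)\le 2k+o(k)$ and $\hat{p}(G_k)\ge \left(\frac13-o(1)\right)k\ln k$, where the $o(\cdot)$ terms are as $k\to\infty$.
   Context: An edge-coloring assigns a color to each edge. Given an edge-coloring, a path (respectively walk) is a parity path (parity walk) if every color appears an even number of times on it (for walks, counted with multiplicity along the traversal); a walk is open if its endpoints are distinct. A parity edge-coloring is an edge-coloring with no parity path; $p(G)$ is the minimum number of colors in one. A strong parity edge-coloring is an edge-coloring with no open parity walk; $\hat{p}(G)$ is the minimum number of colors in one. *)

(* Defs.v *)
From mathcomp Require Import all_boot all_order all_algebra.
From mathcomp Require Import all_classical all_reals all_analysis.

Set Implicit Arguments.
Unset Strict Implicit.
Unset Printing Implicit Defensive.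

Record sgraph := SGraph {
  vertex :> finType;
  adj : rel vertex;
  adj_sym : symmetric adj;
  adj_irrefl : irreflexive adj }.

Definition bipartite (G : sgraph) : Prop :=
  exists A : {set G}, forall x y : G, adj x y -> (x \in A) != (y \in A).

Definition edges (G : sgraph) : {set {set G}} :=
  [set [set z.1; z.2] | z : G * G & adj z.1 z.2].

(* A walk is given by its first vertex [x] and the sequence [p] of the
   following ones, with [path adj x p]; it has [size p] edges. *)
Definition walk_edges (G : sgraph) (x : G) (p : seq G) : seq {set G} :=
  pairmap (fun u v : G => [set u; v]) x p.

(* An edge-coloring is a function on vertex sets of which only the values on
   [edges G] matter; natural numbers serve as an unlimited supply of colors. *)
Definition edge_coloring (G : sgraph) := {set G} -> nat.

Definition ncolors (G : sgraph) (f : edge_coloring G) : nat :=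
  size (undup [seq f e | e in edges G]).

Definition parity_walk (G : sgraph) (f : edge_coloring G) (x : G) (p : seq G)
    : Prop :=
  path (@adj G) x p /\
  forall c : nat, ~~ odd (count_mem c [seq f e | e <- walk_edges x p]).

(* [p != [::]] discards one-vertex paths, on which every color appears zero
   times. *)
Definition parity_path (G : sgraph) (f : edge_coloring G) (x : G) (p : seq G)
    : Prop :=
  [/\ p != [::], uniq (x :: p) & parity_walk f x p].

Definition open_parity_walk (G : sgraph) (f : edge_coloring G)
    (x : G) (p : seq G) : Prop :=
  x != last x p /\ parity_walk f x p.

Definition parity_edge_coloring (G : sgraph) (f : edge_coloring G) : Prop :=
  forall (x : G) (p : seq G), ~ parity_path f x p.

Definition strong_parity_edge_coloring (G : sgraph) (f : edge_coloring G)
    : Prop :=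
  forall (x : G) (p : seq G), ~ open_parity_walk f x p.

Lemma strong_parityW (G : sgraph) (f : edge_coloring G) :
  strong_parity_edge_coloring f -> parity_edge_coloring f.
Proof.
move=> sf x [|y p] [// _ /andP[xNp _] wf].
by apply: (sf x (y :: p)); split=> //=; apply: contraNneq xNp => ->; apply: mem_last.
Qed.

Lemma odd_count_incident (G : sgraph) (v x : G) (p : seq G) :
  path (@adj G) x p ->
  odd (count (fun e : {set G} => v \in e) (walk_edges x p))
    = (v == x) (+) (v == last x p).
Proof.
elim: p x => [|y p IHp] x /=; first by rewrite addbb.
case/andP=> xy /IHp; rewrite oddD oddb in_set2 /walk_edges => ->.
have [->|_] /= := eqVneq v x; last by case: (v == y) => //=; case: (v == _).
have [xy'|_] := eqVneq x y; last by [].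
by rewrite xy' adj_irrefl in xy.
Qed.

Lemma count_sum_mem (T : finType) (a : pred T) (s : seq T) :
  count a s = \sum_(e | a e) count_mem e s.
Proof.
elim: s => [|z s IHs] /=; first by rewrite big1.
rewrite big_split /= -IHs; congr (_ + _)%N.
have [az|naz] := boolP (a z).
  by rewrite (bigD1 z) //= eqxx big1 // => e /andP[_ /negPf ne]; rewrite eq_sym ne.
by rewrite big1 // => e ae; have [ze|//] := eqVneq z e; rewrite ze ae in naz.
Qed.

Lemma pickle_strong_parity (G : sgraph) :
  strong_parity_edge_coloring (pickle : edge_coloring G).
Proof.
move=> x p [xNl [wp even_p]].
have := odd_count_incident x wp.
rewrite eqxx (negPf xNl) /= count_sum_mem => odd_sum.
suff: ~~ odd (\sum_(e : {set G} | x \in e) count_mem e (walk_edges x p)).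
  by rewrite odd_sum.
apply: (big_ind (fun n => ~~ odd n)) => // [m n mE nE|e _].
  by rewrite oddD (negPf mE) (negPf nE).
have := even_p (pickle e); rewrite count_map; congr (~~ odd _).
by apply: eq_count => d /=; rewrite (inj_eq (pcan_inj pickleK)).
Qed.

Lemma parity_number_exists (G : sgraph) :
  exists m : nat, `[< exists2 f : edge_coloring G,
                        parity_edge_coloring f & ncolors f = m >].
Proof.
exists (ncolors (pickle : edge_coloring G)); apply/asboolP.
by exists pickle => //; exact/strong_parityW/pickle_strong_parity.
Qed.

Lemma strong_parity_number_exists (G : sgraph) :
  exists m : nat, `[< exists2 f : edge_coloring G,
                        strong_parity_edge_coloring f & ncolors f = m >].
Proof.
exists (ncolors (pickle : edge_coloring G)); apply/asboolP.
by exists pickle => //; exact: pickle_strong_parity.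
Qed.

Definition parity_number (G : sgraph) : nat := ex_minn (parity_number_exists G).

Definition strong_parity_number (G : sgraph) : nat :=
  ex_minn (strong_parity_number_exists G).

(* Main.v *)
(** Gadget [s] is the blow-up of an [l]-dimensional cube, [l = K / 2^s], in
    which every vertex becomes [i = 2^s] twins labelled by [F_2^s].  The edge
    from [(X, a)] to [(X + e_j, b)] can be coloured [(j, a + b)], so [K] colours
    suffice for each gadget.  Join [S] gadgets to a hub by edges with private
    colours: a path cannot use two gadgets and return, so [K + S] colours give
    no parity path.

    A strong parity coloring, taken modulo the parity vectors of closed walks,
    embeds the whole graph into a space [F_2^n] so that edge differences lie in
    a set [T] with at most one element per color.  If [V] is a subspace of
    dimension [d], some vertex of gadget [s] has at least [i (l - d)] incident
    differences outside [V].  These fall into cosets of [V + <twins>], each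
    containing [i] of them, so [t] new elements of [T] cost only [i + t / i] new
    dimensions.  Running through the gadgets from large [s] to small [s] and
    weighting the inequalities by LP duality gives about [S K / 2] elements in
    [T]; take [S = log_4 k] and [K = 2 k - S]. *)

Require Import Defs.
From mathcomp Require Import all_boot all_order all_algebra all_field.
From mathcomp Require Import boolp zify.
Import Order.TTheory GRing.Theory Num.Theory.

Set Implicit Arguments.
Unset Strict Implicit.
Unset Printing Implicit Defensive.

(** * Induced subgraphs of the cube *)

Definition symdiff (T : finType) (A B : {set T}) : {set T} :=
  [set x | (x \in A) (+) (x \in B)].

Lemma in_symdiff (T : finType) (A B : {set T}) x :
  (x \in symdiff A B) = (x \in A) (+) (x \in B).
Proof. by rewrite inE. Qed.

Lemma symdiffC (T : finType) (A B : {set T}) : symdiff A B = symdiff B A.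
Proof. by apply/setP => x; rewrite !inE addbC. Qed.

Lemma symdiffK (T : finType) (A B : {set T}) : symdiff A (symdiff A B) = B.
Proof. by apply/setP => x; rewrite !inE addbA addbb. Qed.

Lemma symdiffv (T : finType) (A : {set T}) : symdiff A A = set0.
Proof. by apply/setP => x; rewrite !inE addbb. Qed.

Lemma odd_card_symdiff1 (T : finType) (A : {set T}) j :
  odd #|symdiff A [set j]| = ~~ odd #|A|.
Proof.
have [jA|jNA] := boolP (j \in A).
  have -> : symdiff A [set j] = A :\ j.
    apply/setP => x; rewrite !inE; have [->|_] := eqVneq x j; first by rewrite jA.
    by rewrite addbF.
  by rewrite (cardsD1 j A) jA /= negbK.
have -> : symdiff A [set j] = j |: A.
  apply/setP => x; rewrite !inE; have [->|_] := eqVneq x j; last by rewrite addbF.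
  by rewrite (negPf jNA).
by rewrite cardsU1 jNA.
Qed.

(* A separating coordinate splits [F] in two; the smaller half loses at most one
   direction at each vertex. *)
Lemma cube_small_degree (T : finType) (F : {set {set T}}) : F != set0 ->
  exists2 X, X \in F & 2 ^ #|[set j | symdiff X [set j] \in F]| <= #|F|.
Proof.
have [n] := ubnP #|F|; elim: n F => // n IHn F leFn F0.
have [F1|] := leqP #|F| 1.
  have /cards1P[X FX] : #|F| == 1 by rewrite eqn_leq F1 card_gt0.
  exists X; rewrite FX ?set11 // cards1 (_ : [set j | _] = set0) ?cards0 //.
  apply/setP => j; rewrite !inE; apply/negP => /eqP/setP/(_ j).
  by rewrite !inE eqxx addbT; case: (j \in X).
case/card_gt1P => X [Y [XF YF]] XY.
have [j jXY] : exists j, (j \in X) != (j \in Y).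
  apply/existsP; apply: contraNT XY; rewrite negb_exists => /forallP XY.
  by apply/eqP/setP => j; apply/eqP; rewrite -[_ == _]negbK.
pose P b := [set Z in F | (j \in Z) == b].
have PF b : P b \subset F by apply/subsetP => Z; rewrite inE => /andP[].
have P0 b : P b != set0.
  apply/set0Pn; have [jXb|jXb] := eqVneq (j \in X) b; first by exists X; rewrite inE XF jXb /=.
  by exists Y; rewrite inE YF /=; case: b (j \in X) (j \in Y) jXY jXb => [] [] [].
have PU : #|P true| + #|P false| = #|F|.
  rewrite -cardsUI (_ : _ :&: _ = set0) ?cards0 ?addn0.
    by apply: eq_card => Z; rewrite !inE; case: (Z \in F); case: (j \in Z).
  by apply/setP => Z; rewrite !inE; case: (Z \in F); case: (j \in Z).
have [b leb] : exists b, 2 * #|P b| <= #|F|.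
  have [le|lt] := leqP #|P true| #|P false|; [exists true|exists false]; rewrite -PU mul2n -addnn.
    by rewrite leq_add2l.
  by rewrite leq_add2r ltnW.
have [Z ZP leZ] : exists2 Z, Z \in P b &
    2 ^ #|[set i | symdiff Z [set i] \in P b]| <= #|P b|.
  apply: IHn (P0 b); rewrite -ltnS (leq_trans _ leFn) // ltnS -PU.
  have := P0 (~~ b); rewrite -card_gt0; case: b {leb} => ?.
    by rewrite -addn1 leq_add2l.
  by rewrite -add1n leq_add2r.
exists Z; first exact: (subsetP (PF b)).
apply: leq_trans leb; apply: leq_trans (leq_mul (leqnn 2) leZ).
rewrite -expnS leq_exp2l //.
suff: [set i | symdiff Z [set i] \in F] \subset
    j |: [set i | symdiff Z [set i] \in P b].
  by move=> /subset_leq_card/leq_trans -> //; rewrite cardsU1; case: (_ \notin _); rewrite ?leqnSn.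
apply/subsetP => i; rewrite !inE => ->; have [//|ij] := eqVneq i j.
by move: ZP; rewrite inE => /andP[_ /eqP <-]; rewrite addbF eqxx.
Qed.

(** * Subspaces capturing edge differences *)

Lemma addrr_F2 n (v : 'rV['F_2]_n) : (v + v = 0)%R.
Proof. by apply/rowP => j; rewrite !mxE; apply/val_inj; case: (v _ j) => [[|[|]]]. Qed.

Lemma addKr_F2 n (u v : 'rV['F_2]_n) : (u + (u + v) = v)%R.
Proof. by rewrite addrA addrr_F2 add0r. Qed.

(** Each [c] not yet captured raises the dimension by at most one and, since [A] lies in the current
    subspace, brings in the whole coset [c + A]: [#|A|] elements of [T], all new. *)
Lemma dim_span_cosets n (T A : {set 'rV['F_2]_n}) (V : {vspace 'rV['F_2]_n})
    (C : seq 'rV['F_2]_n) :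
  (forall a, a \in A -> a \in V) ->
  (forall c a, c \in C -> a \in A -> (c + a)%R \in T) ->
  #|A| * \dim (V + <<C>>) + #|[set x in T | x \in V]|
    <= #|A| * \dim V + #|[set x in T | x \in (V + <<C>>)%VS]|.
Proof.
move=> AV; elim: C => [|c C IHC] CT; first by rewrite span_nil addv0.
have {IHC} := IHC (fun d a dC => CT d a (mem_behead (s := c :: C) dC)).
rewrite span_cons [(<[c]> + _)%VS]addvC addvA; set U := (V + <<C>>)%VS => IHC.
have [cU|cNU] := boolP (c \in U).
  by rewrite (addv_idPl _) // -memvE.
have cAT a : a \in A -> (c + a)%R \in T by move=> aA; exact: CT (mem_head c C) aA.
have AU a : a \in A -> a \in U by move=> /AV; apply/subvP/addvSl.
have le_dim : \dim (U + <[c]>) <= \dim U + 1.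
  by apply: leq_trans (dimv_add_leqif _ _) _; rewrite leq_add2l dim_vline leq_b1.
have le_card : #|[set x in T | x \in U]| + #|A| <= #|[set x in T | x \in (U + <[c]>)%VS]|.
  have dis : [set x in T | x \in U] :&: [set (c + a)%R | a in A] = set0.
    apply/setP => x; rewrite !inE; apply/negP => /andP[/andP[_ xU]] /imsetP[a aA xE].
    by move: xU; rewrite xE (rpredDr c (AU _ aA)) (negPf cNU).
  rewrite -[#|A|](card_imset _ (addrI c)) -cardsUI dis cards0 addn0.
  apply/subset_leq_card/subsetP => x; rewrite !inE => /orP[/andP[-> xU]|/imsetP[a aA ->]].
    by apply: subvP xU; apply: addvSl.
  by rewrite cAT //= [(c + a)%R]addrC memv_add ?memv_line ?AU.
by have := leq_mul (leqnn #|A|) le_dim; lia.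
Qed.

(* [h X a], [a \in A], are the twins at the cube vertex [X]; the two bounds are
   [t >= i (l - d)] and [d' <= d + i + t / i], where [i = #|A|], [l = #|J|] and
   [t] is the number of elements of [T] in [V'] but not in [V]. *)
Lemma blowup_step n (T : {set 'rV['F_2]_n}) (V : {vspace 'rV['F_2]_n})
    (D L : finType) (J : {set D}) (R : {set {set D}}) (A : {set L})
    (h : {set D} -> L -> 'rV['F_2]_n) :
  R != set0 -> A != set0 ->
  (forall X j, X \in R -> j \in J -> symdiff X [set j] \in R) ->
  (forall X Y a b, X \in R -> Y \in R -> a \in A -> b \in A ->
     h X a = h Y b -> X = Y /\ a = b) ->
  (forall X j a b, X \in R -> j \in J -> a \in A -> b \in A ->
     (h X a + h (symdiff X [set j]) b)%R \in T) ->
  exists V' : {vspace 'rV['F_2]_n},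
    #|A| * #|J| + #|[set x in T | x \in V]|
      <= #|[set x in T | x \in V']| + #|A| * \dim V /\
    #|A| * \dim V' + #|[set x in T | x \in V]|
      <= #|A| * \dim V + #|A| * #|A| + #|[set x in T | x \in V']|.
Proof.
move=> /set0Pn[X1 X1R] /set0Pn[a1 a1A] RJ h_inj hT.
(* The cube vertices with a twin in the same coset of [V] as [h X1 a1]. *)
pose F := [set X in R | [exists a in A, (h X1 a1 + h X a)%R \in V]].
have FR X : X \in F -> X \in R by rewrite inE => /andP[].
have [X0 X0F degX0] : exists2 X, X \in F & 2 ^ #|[set j | symdiff X [set j] \in F]| <= #|F|.
  apply: cube_small_degree; apply/set0Pn; exists X1; rewrite inE X1R.
  by apply/existsP; exists a1; rewrite a1A addrr_F2 mem0v.
(* Choosing one twin per cube vertex injects [F] into [V]; hence at most [\dim V] directions at [X0]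
   stay in [F]. *)
have leF : #|F| <= 2 ^ \dim V.
  pose sel X := odflt a1 [pick a in A | (h X1 a1 + h X a)%R \in V].
  have selP X : X \in F -> sel X \in A /\ (h X1 a1 + h X (sel X))%R \in V.
    rewrite /sel inE => /andP[_ /existsP[a aP]]; case: pickP => [b /andP[]//|/(_ a)].
    by rewrite aP.
  have <- : #|V| = 2 ^ \dim V by rewrite card_vspace card_Fp.
  have inj : {in F &, injective (fun X => h X1 a1 + h X (sel X))%R}.
    by move=> X Y XF YF /addrI/h_inj[] //; rewrite ?FR //; [case: (selP X XF)|case: (selP Y YF)].
  rewrite -(card_in_imset inj); apply/subset_leq_card/subsetP => _ /imsetP[X XF ->].
  by have [] := selP X XF.
have X0R := FR _ X0F.
have {leF} degX0 : #|[set j | symdiff X0 [set j] \in F]| <= \dim V.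
  by rewrite -(leq_exp2l (m := 2)) // (leq_trans degX0).
move: X0F; rewrite inE => /andP[_ /existsP[a0 /andP[a0A a0V]]].
(* [A0] collects the twin differences at [X0], [J'] the directions leaving [F], and [C] the edge
   differences along them from the twin [a0]. No element of [C] lies in [V]: the far endpoint would
   then belong to [F]. *)
pose A0 := [set (h X0 a0 + h X0 a)%R | a in A].
pose J' := [set j in J | symdiff X0 [set j] \notin F].
pose C := [set (h X0 a0 + h (symdiff X0 [set x.1]) x.2)%R | x in setX J' A].
have J'J j : j \in J' -> j \in J by rewrite inE => /andP[].
have cardA0 : #|A0| = #|A|.
  by rewrite card_in_imset // => a b aA bA /addrI/h_inj[].
have cardC : #|C| = #|J'| * #|A|.
  rewrite -cardsX card_in_imset // => -[i a] [j b] /setXP[/= iJ aA] /setXP[/= jJ bA].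
  move=> /addrI/h_inj[]; rewrite ?RJ ?J'J // => /(congr1 (symdiff X0)).
  by rewrite !symdiffK => /set1_inj -> ->.
have leJ' : #|J| <= #|J'| + \dim V.
  rewrite -(cardsID [set j | symdiff X0 [set j] \in F] J) addnC leq_add //.
    by apply/subset_leq_card/subsetP => j; rewrite !inE andbC.
  by rewrite (leq_trans _ degX0) // subset_leq_card // subsetIr.
pose V1 := (V + <<enum A0>>)%VS; pose V' := (V1 + <<enum C>>)%VS.
have dimV1 : \dim V1 <= \dim V + #|A|.
  rewrite (leq_trans (dimv_add_leqif _ _)) // leq_add2l.
  by rewrite (leq_trans (dim_span _)) // -cardE cardA0.
have subVV1 : (V <= V1)%VS by apply: addvSl.
have N1 : #|[set x in T | x \in V]| <= #|[set x in T | x \in V1]|.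
  by apply/subset_leq_card/subsetP => x; rewrite !inE => /andP[-> /(subvP subVV1)].
have CT x : x \in C -> x \in T.
  by case/imsetP => -[j b] /setXP[/= jJ bA] ->; rewrite hT ?J'J.
have CV x : x \in C -> x \notin V.
  case/imsetP => -[j b] /setXP[/= jJ' bA] ->; have jJ := J'J _ jJ'.
  apply: contraL jJ' => cV; rewrite inE jJ /= negbK inE RJ //=.
  apply/existsP; exists b; rewrite bA /=.
  by have := memvD a0V cV; rewrite -addrA addKr_F2.
have CV' x : x \in C -> x \in V'.
  by move=> xC; rewrite (subvP (addvSr _ _)) // memv_span // mem_enum.
(* Adding the twin difference of [a'] to an element of [C] moves the edge from twin [a0] to twin
   [a'], so the translates of [A0] by [C] stay in [T]. *)
have span_le : #|A0| * \dim V' + #|[set x in T | x \in V1]|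
    <= #|A0| * \dim V1 + #|[set x in T | x \in V']|.
  apply: dim_span_cosets => [a aA0|c a].
    by rewrite (subvP (addvSr _ _)) // memv_span // mem_enum.
  rewrite mem_enum => /imsetP[[j b] /setXP[/= jJ bA] ->] /imsetP[a' aA ->].
  by rewrite addrC -addrA [(h X0 a' + _)%R]addrCA addKr_F2 hT ?J'J.
have N2 : #|[set x in T | x \in V]| + #|C| <= #|[set x in T | x \in V']|.
  rewrite -cardsUI (_ : _ :&: C = set0) ?cards0 ?addn0.
    apply/subset_leq_card/subsetP => x; rewrite !inE => /orP[/andP[-> xV]|xC].
      by rewrite (subvP (addvSl _ _)) // (subvP subVV1).
    by rewrite CT ?CV'.
  apply/setP => x; rewrite !inE; have [xC|] := boolP (x \in C); last by rewrite andbF.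
  by rewrite (negPf (CV _ xC)) andbF.
exists V'; split; first by have := leq_mul (leqnn #|A|) leJ'; lia.
by have := leq_mul (leqnn #|A|) dimV1; rewrite cardA0 in span_le; lia.
Qed.

(** * The embedding defined by a strong parity coloring *)

(** The basis vector of color [c], or zero when [n <= c]; summing along a walk records the parity of
    each color below [n]. *)
Definition color_vec n (c : nat) : 'rV['F_2]_n := (\row_j (val j == c)%:R)%R.

Definition walk_vec n (G : sgraph) (f : edge_coloring G) (x : G) (p : seq G)
    : 'rV['F_2]_n :=
  (\sum_(e <- walk_edges x p) color_vec n (f e))%R.

Lemma walk_vec_cat n (G : sgraph) (f : edge_coloring G) (x : G) (p q : seq G) :
  (walk_vec n f x (p ++ q) = walk_vec n f x p + walk_vec n f (last x p) q)%R.
Proof. by rewrite /walk_vec /walk_edges pairmap_cat big_cat. Qed.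

Lemma walk_vec1 n (G : sgraph) (f : edge_coloring G) (x y : G) :
  walk_vec n f x [:: y] = color_vec n (f [set x; y]).
Proof. by rewrite /walk_vec /walk_edges /= big_seq1. Qed.

Lemma walk_vec_rev n (G : sgraph) (f : edge_coloring G) (x : G) (p : seq G) :
  walk_vec n f (last x p) (rev (belast x p)) = walk_vec n f x p.
Proof.
elim: p x => [|y p IHp] x //=; rewrite rev_cons -cats1 walk_vec_cat IHp addrC.
rewrite -[y :: p]cat1s walk_vec_cat /=; congr (_ + _)%R.
rewrite !walk_vec1 setUC; congr (color_vec _ (f (_ |: [set _]))).
by case: p {IHp} => //= z p; rewrite rev_cons last_rcons.
Qed.

Lemma path_adj_rev (G : sgraph) (x : G) (p : seq G) :
  path (@adj G) x p -> path (@adj G) (last x p) (rev (belast x p)).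
Proof. by rewrite rev_path (eq_path (e' := @adj G)) // => u v; apply: adj_sym. Qed.

Lemma last_rev_belast (G : sgraph) (x : G) (p : seq G) :
  last (last x p) (rev (belast x p)) = x.
Proof. by case: p => //= y p; rewrite rev_cons last_rcons. Qed.

Lemma walk_vec_eq0 n (G : sgraph) (f : edge_coloring G) (x : G) (p : seq G) :
  (forall e, f e < n) ->
  walk_vec n f x p = 0%R ->
  forall c, ~~ odd (count_mem c [seq f e | e <- walk_edges x p]).
Proof.
move=> fn w0 c; have [cn|nc] := ltnP c n; last first.
  rewrite (count_memPn _) //; apply/mapP => -[e _ ce].
  by have := fn e; rewrite -ce ltnNge nc.
have := congr1 (fun v : 'rV_n => v 0%R (Ordinal cn)) w0.
rewrite /walk_vec summxE mxE -dvdn2 (dvdn_pcharf (pchar_Fp (isT : prime 2))) => sum0.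
apply/eqP; rewrite -sum0 count_map; elim: (walk_edges x p) => [|e s IHs].
  by rewrite big_nil.
by rewrite big_cons /= natrD IHs mxE eq_sym.
Qed.

(** [g] is the parity vector of a walk from [x0], modulo the vectors of closed walks at [x0]. The
    quotient makes the choice of walk irrelevant, and a collision of [g] would yield an open parity
    walk. *)
Lemma strong_coloring_potential (G : sgraph) (f : edge_coloring G) (x0 : G) :
  strong_parity_edge_coloring f ->
  exists n (g : G -> 'rV['F_2]_n) (tau : nat -> 'rV['F_2]_n),
    (forall u v, connect (@adj G) x0 u -> adj u v ->
       (g u + g v)%R = tau (f [set u; v])) /\
    (forall u v, connect (@adj G) x0 u -> connect (@adj G) x0 v ->
       g u = g v -> u = v).
Proof.
move=> strong_f.
pose n := (\max_(e : {set G}) f e).+1.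
have fn e : f e < n by rewrite ltnS leq_bigmax.
pose closed_vec (w : 'rV['F_2]_n) :=
  exists p, [/\ path (@adj G) x0 p, last x0 p = x0 & walk_vec n f x0 p = w].
have closed0 : closed_vec 0%R by exists [::]; split => //; rewrite /walk_vec big_nil.
have closedD v w : closed_vec v -> closed_vec w -> closed_vec (v + w)%R.
  case=> p [pp lp <-] [q [pq lq <-]]; exists (p ++ q).
  by rewrite cat_path last_cat walk_vec_cat lp pp.
pose S := [seq w <- enum 'rV['F_2]_n | `[< closed_vec w >]].
pose W : {vspace 'rV['F_2]_n} := <<S>>%VS.
(* Concatenation makes closed-walk vectors stable under sums, and the only scalars are 0 and 1, so
   they already form a subspace. *)
have WP w : w \in W <-> closed_vec w.
  split=> [|cw]; last first.
    by apply: memv_span; rewrite mem_filter mem_enum andbT; apply/asboolP.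
  move=> wW; rewrite (coord_span (X := in_tuple S) wW); apply: big_ind => // i _.
  have : ((in_tuple S)`_i)%R \in S by apply: mem_nth.
  rewrite mem_filter => /andP[/asboolP cl _].
  case: (coord _ _ _) => [[|[|//]] k_lt].
    by rewrite (_ : Ordinal k_lt = 0%R) ?scale0r //; apply/val_inj.
  by rewrite (_ : Ordinal k_lt = 1%R) ?scale1r //; apply/val_inj.
have /choice[P walkP] : forall u, exists p,
    connect (@adj G) x0 u -> path (@adj G) x0 p /\ last x0 p = u.
  move=> u; have [/connectP[p pp ->]|_] := boolP (connect (@adj G) x0 u).
    by exists p.
  by exists [::].
have walk_rev u : connect (@adj G) x0 u ->
    [/\ path (@adj G) u (rev (belast x0 (P u))), last u (rev (belast x0 (P u))) = x0
      & walk_vec n f u (rev (belast x0 (P u))) = walk_vec n f x0 (P u)].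
  move=> cu; have [pu lu] := walkP u cu; have := path_adj_rev pu.
  by have := last_rev_belast x0 (P u); have := walk_vec_rev n f x0 (P u); rewrite lu.
(* [q] has kernel [W], so it stands for the projection onto the quotient by [W]. *)
pose q (v : 'rV['F_2]_n) := (v - projv W v)%R.
have qD u v : q (u + v)%R = (q u + q v)%R by rewrite /q linearD opprD addrACA.
have q0 v : v \in W -> q v = 0%R by move=> vW; rewrite /q projv_id ?subrr.
have qW v : q v = 0%R -> v \in W.
  by move=> /eqP; rewrite subr_eq0 => /eqP ->; apply: memv_proj.
exists n, (fun u => q (walk_vec n f x0 (P u))), (fun c => q (color_vec n c)).
split=> [u v cu uv|u v cu cv /eqP guv].
  have cv : connect (@adj G) x0 v := connect_trans cu (connect1 uv).
  have [[pu lu] [pv lv]] := (walkP u cu, walkP v cv).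
  have [prv lrv vrv] := walk_rev v cv.
  rewrite -qD -[RHS]addr0 -[in RHS](q0 (walk_vec n f x0 (P u) + walk_vec n f x0 (P v)
    + color_vec n (f [set u; v]))%R).
    by rewrite [q (_ + color_vec _ _)%R]qD [RHS]addrC -addrA addrr_F2 addr0.
  (* The closed walk goes out to [u], crosses to [v] and returns. *)
  apply/WP; exists (P u ++ v :: rev (belast x0 (P v))).
  rewrite cat_path last_cat lu /= uv pu prv lrv.
  split=> //; rewrite walk_vec_cat -[v :: _]cat1s walk_vec_cat lu walk_vec1 /=.
  by rewrite vrv -addrA [(color_vec _ _ + _)%R]addrC.
apply/eqP/contraT => uNv.
have [[pu lu] [pv lv]] := (walkP u cu, walkP v cv).
have /WP[p [pp lp wp]] : (walk_vec n f x0 (P u) + walk_vec n f x0 (P v))%R \in W.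
  by apply: qW; rewrite qD (eqP guv) addrr_F2.
(* Back from [u] to [x0], around the closed walk [p], then out to [v]: the three parity vectors
   cancel. *)
case: (strong_f u (rev (belast x0 (P u)) ++ p ++ P v)).
have [pru lru vru] := walk_rev u cu.
split; first by rewrite !last_cat lru lp lv.
split; first by rewrite !cat_path lru lp pp pv pru.
apply: (@walk_vec_eq0 n _ _ _ _ fn).
by rewrite !walk_vec_cat lru lp wp vru -addrA addKr_F2 addrr_F2.
Qed.

(** * Gadgets joined to a hub *)

Definition directions K s : {set 'I_K} := [set j : 'I_K | j < K %/ 2 ^ s].

(** A model of [F_2^s] with [symdiff] as addition. *)
Definition labels S s : {set {set 'I_S}} := powerset [set r : 'I_S | r < s].

(* [None] is the hub, [Some (s, X, a)] is the twin [a] of the cube vertex [X] in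
   gadget [s].  Vertices whose [X] is not included in [directions K s], or whose
   [a] is not in [labels S s], are not connected to the hub. *)
Definition hub_vertex S K := option ('I_S * {set 'I_K} * {set 'I_S}).

Definition hub_adj S K (u v : hub_vertex S K) : bool :=
  match u, v with
  | Some (s, X, a), Some (t, Y, b) =>
      [&& s == t, a \in labels S s, b \in labels S s &
          [exists j in directions K s, symdiff X Y == [set j]]]
  | Some (_, X, a), None | None, Some (_, X, a) => (X == set0) && (a == set0)
  | None, None => false
  end.

Lemma hub_adj_sym S K : symmetric (@hub_adj S K).
Proof.
move=> [[[s X] a]|] [[[t Y] b]|] //=; rewrite symdiffC [s == t]eq_sym.
by have [->|//] := eqVneq t s; rewrite /= andbCA.
Qed.

Lemma hub_adj_irrefl S K : irreflexive (@hub_adj S K).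
Proof.
move=> [[[s X] a]|] //=; apply/negP => /and4P[_ _ _ /existsP[j /andP[_]]].
by rewrite symdiffv eq_sym => /eqP/setP/(_ j); rewrite !inE eqxx.
Qed.

Definition hub_graph S K := SGraph (@hub_adj_sym S K) (@hub_adj_irrefl S K).

Lemma hub_graph_bipartite S K : bipartite (hub_graph S K).
Proof.
exists [set v : hub_vertex S K | if v is Some (_, X, _) then odd #|X| else true].
move=> [[[s X] a]|] [[[t Y] b]|] //=; rewrite !inE.
- case/and4P => _ _ _ /existsP[j /andP[_ /eqP XY]].
  by rewrite -(symdiffK X Y) XY odd_card_symdiff1; case: odd.
- by case/andP => /eqP -> _; rewrite cards0.
- by case/andP => /eqP -> _; rewrite cards0.
Qed.

(** * The parity coloring of the hub graph *)

Lemma card_labels S s : s <= S -> #|labels S s| = 2 ^ s.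
Proof.
move=> sS; rewrite card_powerset; congr (2 ^ _).
rewrite -[RHS](card_ord s) -(@card_imset _ _ (widen_ord sS)); last first.
  by move=> i j /(congr1 val) /= ij; apply/val_inj.
apply: eq_card => r; rewrite inE; apply/idP/imsetP => [rs|[i _ ->]]; last exact: (ltn_ord i).
by exists (Ordinal rs) => //; apply/val_inj.
Qed.

Lemma symdiff_labels S s (a b : {set 'I_S}) :
  a \in labels S s -> b \in labels S s -> symdiff a b \in labels S s.
Proof.
rewrite !powersetE => /subsetP as_ /subsetP bs; apply/subsetP => r.
rewrite in_symdiff; have [/as_ //|_] := boolP (r \in a).
by have [/bs //|] := boolP (r \in b).
Qed.

(** Direction [j] owns the block of [2 ^ s] colors starting at [j * 2 ^ s], and the label sum picks
    one of them. All gadgets share these colors; hub edges have private ones from [K] on. The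
    default [0] occurs only at non-edges. *)
Definition hub_color S K (u v : hub_vertex S K) : nat :=
  match u, v with
  | Some (s, X, a), Some (t, Y, b) =>
      if [pick j in symdiff X Y] is Some j
      then j * 2 ^ s + index (symdiff a b) (enum (labels S s)) else 0
  | Some (s, _, _), None | None, Some (s, _, _) => K + s
  | None, None => 0
  end.

Lemma hub_color_sym S K (u v : hub_vertex S K) :
  hub_adj u v -> hub_color u v = hub_color v u.
Proof.
case: u v => [[[s X] a]|] [[[t Y] b]|] //= /and4P[/eqP <- _ _ _].
by rewrite symdiffC [symdiff a b]symdiffC.
Qed.

Variant gadget_edge_spec S K s (X Y : {set 'I_K}) (a b : {set 'I_S}) (c : nat)
    : Prop :=
  GadgetEdge (j : 'I_K) of symdiff X Y = [set j] & c %/ 2 ^ s = j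
    & nth set0 (enum (labels S s)) (c %% 2 ^ s) = symdiff a b & c < K.

Lemma gadget_edgeP S K (s t : 'I_S) (X Y : {set 'I_K}) (a b : {set 'I_S}) :
  hub_adj (Some (s, X, a)) (Some (t, Y, b)) ->
  s = t /\ gadget_edge_spec s X Y a b (hub_color (Some (s, X, a)) (Some (t, Y, b))).
Proof.
case/and4P => /eqP <- aL bL /existsP[j /andP[jD /eqP XY]]; split => //=.
have -> : [pick i in symdiff X Y] = Some j.
  by case: pickP => [i|/(_ j)]; rewrite XY inE => /eqP // ->.
have idx_lt : index (symdiff a b) (enum (labels S s)) < 2 ^ s.
  rewrite -(@card_labels S s) ?(ltnW (ltn_ord s)) // cardE index_mem mem_enum.
  exact: symdiff_labels.
have p0 : 0 < 2 ^ s by rewrite expn_gt0.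
exists j => //.
- by rewrite divnMDl // divn_small ?addn0.
- by rewrite modnMDl modn_small // nth_index // mem_enum symdiff_labels.
move: jD; rewrite inE => jD; apply: leq_trans (leq_trunc_div K (2 ^ s)).
by apply: leq_trans (leq_mul jD (leqnn _)); rewrite mulSn addnC ltn_add2r.
Qed.

Lemma set2_inj (T : finType) (a b c d : T) :
  [set a; b] = [set c; d] -> (a = c /\ b = d) \/ (a = d /\ b = c).
Proof.
move=> e; have := set21 a b; have := set22 a b; have := set21 c d; have := set22 c d.
rewrite {1 2}e -{1 2}e !inE.
by do 4![case/orP => /eqP ?]; subst; auto.
Qed.

Lemma edge_coloring_of_sym (G : sgraph) (col : G -> G -> nat) :
  (forall u v, adj u v -> col u v = col v u) ->
  exists f : edge_coloring G, forall u v, adj u v -> f [set u; v] = col u v.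
Proof.
move=> col_sym; exists (fun e : {set G} =>
  if [pick z : G * G | adj z.1 z.2 && (e == [set z.1; z.2])] is Some z
  then col z.1 z.2 else 0) => u v uv.
case: pickP => [[w z] /= /andP[wz /eqP/set2_inj[[-> ->]|[-> ->]]]|/(_ (u, v))] //.
  exact: col_sym.
by rewrite /= uv eqxx.
Qed.

Lemma even_count (T : eqType) (Q : pred T) (s : seq T) :
  (forall c, ~~ odd (count_mem c s)) -> ~~ odd (count Q s).
Proof.
move=> even_s; suff -> : odd (count Q s) = \big[addb/false]_(c <- undup s) false.
  by rewrite big1_eq.
have -> : odd (count Q s) = \big[addb/false]_(c <- s) Q c.
  by elim: s {even_s} => [|c s IHs]; rewrite ?big_nil // big_cons /= oddD oddb IHs.
rewrite -big_undup_iterop_count; apply: eq_bigr => c _.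
transitivity (odd (count_mem c s) && Q c); last by rewrite (negPf (even_s c)).
rewrite Monoid.iteropE; elim: (count_mem c s) => //= n ->.
by case: odd (Q c) => [] [].
Qed.

(** Telescoping: [P] changes exactly across edges whose color satisfies [Q]. If every color count is
    even, [P] therefore agrees at both ends. *)
Lemma odd_count_potential (G : sgraph) (f : edge_coloring G) (e : rel G)
    (P : pred G) (Q : pred nat) (x : G) (p : seq G) :
  (forall u v, e u v -> P u (+) P v = Q (f [set u; v])) -> path e x p ->
  odd (count Q [seq f d | d <- walk_edges x p]) = P x (+) P (last x p).
Proof.
move=> PQ; elim: p x => [|y p IHp] x /=; first by rewrite addbb.
by case/andP => xy /IHp; rewrite oddD oddb -PQ // => ->; rewrite addbA addbK.
Qed.

Definition in_gadget S K (s : 'I_S) (v : hub_vertex S K) : bool :=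
  if v is Some (t, _, _) then t == s else false.

Lemma hub_path_in_gadget S K (s : 'I_S) (x : hub_vertex S K) (p : seq (hub_vertex S K)) :
  path (@hub_adj S K) x p -> None \notin p -> in_gadget s x ->
  path [rel u v | [&& hub_adj u v, in_gadget s u & in_gadget s v]] x p /\
  in_gadget s (last x p).
Proof.
elim: p x => [|y p IHp] x //= /andP[xy py]; rewrite inE negb_or => /andP[yN pN] xs.
have ys : in_gadget s y.
  by case: x y xy {IHp py} yN xs => [[[? ?] ?]|] [[[? ?] ?]|] //= /and4P[/eqP <-].
by have [-> ->] := IHp y py pN ys; rewrite xy xs ys.
Qed.

Lemma hub_graph_parity_coloring S K :
  exists2 f : edge_coloring (hub_graph S K),
    parity_edge_coloring f & ncolors f <= K + S.
Proof.
have [f fE] := @edge_coloring_of_sym (hub_graph S K) (@hub_color S K) (@hub_color_sym S K).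
exists f; last first.
  rewrite /ncolors -[X in _ <= X](size_iota 0).
  apply: uniq_leq_size (undup_uniq _) _ => c; rewrite mem_undup mem_iota add0n /=.
  case/mapP => e; rewrite mem_enum => /imsetP[[u v] uv ->] ->.
  rewrite inE /= in uv; rewrite fE //.
  case: u v uv => [[[s X] a]|] [[[t Y] b]|] //=; rewrite ?ltn_add2l ?ltn_ord //.
  by case/gadget_edgeP => _ [? _ _ _ /leq_trans -> //]; rewrite leq_addr.
move=> x p [p0 /=/andP[xNp p_uniq] [xp even_p]].
have last_p : last x p \in p by case: p p0 {xNp p_uniq xp even_p} => //= y p _; apply: mem_last.
have x_last : x != last x p by apply: contraNneq xNp => ->.
(* Membership in gadget [s] changes exactly at the edge of private color [K + s]. So the distinct
   ends lie in one common gadget, and neither is the hub. *)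
have same_gadget s : in_gadget s x = in_gadget s (last x p).
  apply/eqP; rewrite -negb_add.
  rewrite -(odd_count_potential (f := f) (e := @hub_adj S K) (Q := pred1 (K + s))) //.
  move=> u v uv; rewrite fE //.
  case: u v uv => [[[s1 X] a]|] [[[t Y] b]|] //=.
  - case/gadget_edgeP => -> [j _ _ _ cK]; rewrite addbb; apply/esym/eqP => cE.
    by move: cK; rewrite /= cE -ltn_subRL subnn.
  - by rewrite addbF eqn_add2l.
  - by rewrite eqn_add2l.
case: x => [[[s X] a]|] in xp xNp even_p last_p x_last same_gadget *; last first.
  by case: (last _ _) x_last same_gadget => [[[t Y] b]|] // _ /(_ t); rewrite /= eqxx.
have xs : in_gadget s (Some (s, X, a) : hub_vertex S K) by rewrite /= eqxx.
have last_s := same_gadget s; rewrite xs in last_s.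
(* A path through the hub would leave and re-enter gadget [s] by the same vertex, the one with [X]
   and [a] empty. *)
have [pN|NNp] := boolP (None \in p).
  case/splitPr: pN => p1 p2 in xp xNp p_uniq last_s {p0 even_p last_p x_last same_gadget}.
  move: xp p_uniq xNp last_s; rewrite cat_path cat_uniq last_cat /= negb_or.
  move=> /and3P[xp1 yN Np2] /and3P[p1_uniq /andP[Np1 p1p2] /andP[Np2' p2_uniq]].
  rewrite mem_cat negb_or inE => /andP[xNp1 xNp2].
  have [_] := hub_path_in_gadget xp1 Np1 xs.
  case yE : (last _ p1) yN => [[[s' X'] a']|] //= /andP[/eqP X'0 /eqP a'0] /eqP s's.
  case: p2 => // z p2 in Np2 Np2' p1p2 p2_uniq xNp2 *.
  move: Np2 => /= /andP[]; case: z => [[[t Y] b]|] // in Np2' p1p2 p2_uniq xNp2 *.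
  move=> /andP[/eqP Y0 /eqP b0] tp2; move: Np2'; rewrite inE negb_or /= => Np2'.
  have [_] := hub_path_in_gadget tp2 Np2' (eqxx t).
  case: (last _ p2) => [[[t' ?] ?]|] //= /eqP -> /esym/eqP ts.
  have : Some (s', X', a') \in Some (s, X, a) :: p1 by rewrite -yE mem_last.
  rewrite X'0 a'0 s's -ts -Y0 -b0 inE => /orP[/eqP yx|yp1].
    by move: xNp2; rewrite yx -ts inE eqxx.
  by move/hasPn: p1p2 => /(_ _ (mem_head _ _)); rewrite /= yp1.
have [gp _] := hub_path_in_gadget xp NNp xs.
have gadget_pot (P : pred (hub_vertex S K)) (Q : pred nat) :
    (forall X Y a b, hub_adj (Some (s, X, a)) (Some (s, Y, b)) ->
      P (Some (s, X, a)) (+) P (Some (s, Y, b))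
        = Q (hub_color (Some (s, X, a)) (Some (s, Y, b)))) ->
    P (Some (s, X, a)) = P (last (Some (s, X, a)) p).
  move=> PQ; apply/eqP; rewrite -negb_add.
  rewrite -(odd_count_potential (f := f) (Q := Q) _ gp); first exact: even_count.
  move=> u v /and3P[uv us vs]; rewrite fE //.
  case: u v uv us vs => [[[s1 X1] a1]|] [[[s2 X2] a2]|] // uv /eqP s1s /eqP s2s.
  by rewrite s1s s2s in uv *; rewrite PQ.
case lastE : (last _ p) last_s x_last gadget_pot => [[[t Y] b]|] //= /esym/eqP -> x_last gadget_pot.
(* Inside one gadget, each coordinate of [X] and each bit of the label is a potential whose change
   is read off the color, so the ends coincide. *)
have XY : X = Y.
  apply/setP => j; apply: (gadget_pot
    (fun v => if v is Some (_, Z, _) then j \in Z else false) (fun c => c %/ 2 ^ s == j)).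
  move=> X1 Y1 a1 b1 /gadget_edgeP[_ [i XY ci _ _]].
  by rewrite ci -in_symdiff XY inE eq_sym.
have ab : a = b.
  apply/setP => r; apply: (gadget_pot
    (fun v => if v is Some (_, _, d) then r \in d else false)
    (fun c => r \in nth set0 (enum (labels S s)) (c %% 2 ^ s))).
  by move=> X1 Y1 a1 b1 /gadget_edgeP[_ [i _ _ ab _]]; rewrite ab in_symdiff.
by move: x_last; rewrite XY ab eqxx.
Qed.

(** * Counting colors of a strong coloring *)

Lemma card_directions K s : #|directions K s| = K %/ 2 ^ s.
Proof.
have le_K : K %/ 2 ^ s <= K by apply: leq_div.
rewrite -[RHS](card_ord (K %/ 2 ^ s)) -(@card_imset _ _ (widen_ord le_K)); last first.
  by move=> i j /(congr1 val) /= ij; apply/val_inj.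
apply: eq_card => j; rewrite inE; apply/idP/imsetP => [js|[i _ ->]]; last exact: (ltn_ord i).
by exists (Ordinal js) => //; apply/val_inj.
Qed.

Lemma set0_labels S s : set0 \in labels S s.
Proof. by rewrite powersetE sub0set. Qed.

Lemma hub_adj_flip S K (s : 'I_S) (X : {set 'I_K}) (a b : {set 'I_S}) j :
  j \in directions K s -> a \in labels S s -> b \in labels S s ->
  hub_adj (Some (s, X, a)) (Some (s, symdiff X [set j], b)).
Proof.
move=> jK aL bL; rewrite /= eqxx aL bL; apply/existsP; by exists j; rewrite jK symdiffK eqxx.
Qed.

(** Elements of [X] are removed one by one. At [X = set0], flipping a direction back and forth
    changes the label; [2 ^ s <= K] ensures that a direction exists. *)
Lemma hub_graph_connect S K (s : 'I_S) (X : {set 'I_K}) (a : {set 'I_S}) :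
  2 ^ s <= K -> X \subset directions K s -> a \in labels S s ->
  connect (@adj (hub_graph S K)) None (Some (s, X, a)).
Proof.
move=> leK; have [j0 j0K] : exists j, j \in directions K s.
  by apply/set0Pn; rewrite -card_gt0 card_directions divn_gt0 // expn_gt0.
have step Y j b c : j \in directions K s -> b \in labels S s -> c \in labels S s ->
    connect (@adj (hub_graph S K)) None (Some (s, symdiff Y [set j], b)) ->
    connect (@adj (hub_graph S K)) None (Some (s, Y, c)).
  move=> jK bL cL /connect_trans; apply; apply: connect1.
  by rewrite adj_sym; apply: hub_adj_flip.
have [n] := ubnP #|X|; elim: n X a => // n IHn X a leXn XK aL.
have [->|/set0Pn[j jX]] := eqVneq X set0.
  apply: (step _ _ set0 _ j0K) => //; first exact: set0_labels.
  apply: (@connect_trans _ _ (Some (s, set0, set0))); apply: connect1.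
    by rewrite /= !eqxx.
  by apply: hub_adj_flip; rewrite ?set0_labels.
have flipE : symdiff X [set j] = X :\ j.
  apply/setP => i; rewrite !inE; have [->|_] := eqVneq i j; first by rewrite jX.
  by rewrite addbF.
apply: (step _ _ set0 _ (subsetP XK _ jX)) => //; first exact: set0_labels.
rewrite flipE; apply: IHn; last exact: set0_labels.
  by move: leXn; rewrite (cardsD1 j X) jX.
exact: subset_trans (subsetDl _ _) XK.
Qed.

Lemma hub_strong_coloring_bound S K (f : edge_coloring (hub_graph S K)) :
  2 ^ S <= K -> strong_parity_edge_coloring f ->
  \sum_(0 <= s < S) 2 ^ s * (K %/ 2 ^ s) <= 2 * ncolors f + \sum_(0 <= s < S) 4 ^ s.
Proof.
move=> leK strong_f.
have [n [g [tau [g_edge g_inj]]]] := strong_coloring_potential (None : hub_graph S K) strong_f.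
pose T := [set tau (f e) | e in edges (hub_graph S K)].
have leT : #|T| <= ncolors f.
  rewrite /ncolors -(size_map tau); apply: leq_trans (card_size _).
  apply/subset_leq_card/subsetP => _ /imsetP[e eG ->].
  by rewrite map_f // mem_undup; apply: image_f.
suff [V V_le] : exists V : {vspace 'rV['F_2]_n},
    \sum_(0 <= s < S) 2 ^ s * (K %/ 2 ^ s) + 2 ^ 0 * \dim V
      <= 2 * #|[set x in T | x \in V]| + \sum_(0 <= s < S) 4 ^ s.
  have : #|[set x in T | x \in V]| <= #|T|.
    by apply/subset_leq_card/subsetP => x; rewrite inE => /andP[].
  by move: V_le; lia.
(* The dimension term is the slack of the dual solution with all weights 1/2. *)
suff step t m : m + t = S -> exists V : {vspace 'rV['F_2]_n},
    \sum_(m <= s < S) 2 ^ s * (K %/ 2 ^ s) + 2 ^ m * \dim V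
      <= 2 * #|[set x in T | x \in V]| + \sum_(m <= s < S) 4 ^ s.
  exact: (step S).
elim: t m => [|t IHt] m mS.
  by exists 0%VS; rewrite -mS addn0 !big_geq // dimv0 muln0.
have [|V IHV] := IHt m.+1; first by rewrite addSnnS.
have m_lt : m < S by rewrite -mS -addSnnS leq_addr.
pose s := Ordinal m_lt.
have leKm : 2 ^ m <= K by apply: leq_trans leK; rewrite leq_exp2l // ltnW.
have conn X a : X \in powerset (directions K m) -> a \in labels S m ->
    connect (@adj (hub_graph S K)) None (Some (s, X, a)).
  by rewrite powersetE => XK aL; apply: hub_graph_connect.
have flip X j : X \in powerset (directions K m) -> j \in directions K m ->
    symdiff X [set j] \in powerset (directions K m).
  rewrite !powersetE => /subsetP XK jK; apply/subsetP => i; rewrite in_symdiff inE.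
  by have [/XK|_ /eqP ->] := boolP (i \in X).
have [] := @blowup_step n T V _ _ (directions K m) (powerset (directions K m))
  (labels S m) (fun X a => g (Some (s, X, a))).
- by apply/set0Pn; exists set0; rewrite powersetE sub0set.
- by apply/set0Pn; exists set0; apply: set0_labels.
- exact: flip.
- by move=> X Y a b XK YK aL bL /g_inj; rewrite !conn // => /(_ isT isT)[].
- move=> X j a b XK jK aL bL.
  have edge : @adj (hub_graph S K) (Some (s, X, a)) (Some (s, symdiff X [set j], b)).
    exact: hub_adj_flip.
  rewrite g_edge ?conn //; apply: imset_f.
  by apply/imsetP; exists (Some (s, X, a), Some (s, symdiff X [set j], b)); rewrite ?inE.
move=> V'; rewrite card_labels ?card_directions ?(ltnW m_lt) // => -[colors_ge dim_le].
exists V'; rewrite !(big_ltn m_lt) (_ : 4 ^ m = 2 ^ m * 2 ^ m) ; last by rewrite -expnMn.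
(* The two inequalities of the step are added: the resulting cost [2 * 2 ^ m * \dim V] is exactly
   the dimension term of the induction hypothesis at [m.+1]. *)
move: IHV colors_ge dim_le; rewrite expnS -!mulnA.
move: (2 ^ m * \dim V) (2 ^ m * \dim V') (2 ^ m * (K %/ 2 ^ m)) (2 ^ m * 2 ^ m).
move: (\sum_(_ <= _ < _) _) (\sum_(_ <= _ < _) _).
move: #|[set x in T | x \in V]| #|[set x in T | x \in V']|.
lia.
Qed.

(** * Choice of the parameters *)

Lemma sum_expn_le b S : 1 < b -> \sum_(0 <= s < S) b ^ s <= b ^ S.
Proof.
move=> b1; elim: S => [|S IHS]; first by rewrite big_geq.
rewrite big_nat_recr //= expnS (leq_trans _ (leq_mul b1 (leqnn _))) //.
by rewrite mul2n -addnn leq_add2r.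
Qed.

Lemma parity_number_hub S K : parity_number (hub_graph S K) <= K + S.
Proof.
rewrite /parity_number; case: ex_minnP => m _ min_m.
have [f parity_f le_f] := hub_graph_parity_coloring S K.
by apply: leq_trans le_f; apply: min_m; apply/asboolP; exists f.
Qed.

(** Rounding in [K %/ 2 ^ s] loses less than [2 ^ s] per gadget, whence the term [2 ^ S]; the term
    [4 ^ S] pays for the twin differences. *)
Lemma strong_parity_number_hub S K : 2 ^ S <= K ->
  S * K <= 2 * strong_parity_number (hub_graph S K) + 4 ^ S + 2 ^ S.
Proof.
move=> leK; rewrite /strong_parity_number; case: ex_minnP => _ /asboolP[f strong_f <-] _.
have := hub_strong_coloring_bound leK strong_f.
have : S * K <= \sum_(0 <= s < S) 2 ^ s * (K %/ 2 ^ s) + \sum_(0 <= s < S) 2 ^ s.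
  rewrite -[S in S * K]subn0 -sum_nat_const_nat -big_split /= leq_sum // => s _.
  by rewrite -mulnSr mulnC ltnW // ltn_ceil // expn_gt0.
have := @sum_expn_le 2 S isT; have := @sum_expn_le 4 S isT; lia.
Qed.

(** This keeps [4 ^ S] below or equal to [k] for positive [k], while the number of gadgets still
    grows like [ln k]. *)
Definition gap_size k := trunc_log 4 k.

Definition gap_graph k := hub_graph (gap_size k) (2 * k - gap_size k).

(** With [S = gap_size k], each of the three errors [S * S], [4 ^ S] and [2 ^ S] is at most [k]. *)
Lemma gap_graph_bounds k : 0 < k ->
  parity_number (gap_graph k) <= 2 * k /\
  2 * (gap_size k * k) <= 2 * strong_parity_number (gap_graph k) + 3 * k.
Proof.
move=> k0; have S4 : 4 ^ gap_size k <= k by apply: trunc_logP.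
have S2 : 2 ^ gap_size k <= 4 ^ gap_size k by rewrite (expnMn 2 2) leq_pmulr // expn_gt0.
have SS : gap_size k * gap_size k <= 4 ^ gap_size k.
  by rewrite (expnMn 2 2) leq_mul // ltnW // ltn_expl.
have leS : gap_size k <= k by apply: leq_trans S4; rewrite ltnW // ltn_expl.
split; first by rewrite (leq_trans (parity_number_hub _ _)) // subnK // (leq_trans leS) // leq_pmull.
have leK : 2 ^ gap_size k <= 2 * k - gap_size k by move: S2 S4; lia.
have := strong_parity_number_hub leK; rewrite mulnBr -/(gap_graph k) mulnCA.
by move: S2 S4 SS; move: (gap_size k * gap_size k) (gap_size k * k); lia.
Qed.

(** * Asymptotics *)

From mathcomp Require Import all_boot all_order all_algebra.
From mathcomp Require Import all_classical all_reals all_analysis.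
From mathcomp Require Import lra.
Import Order.TTheory GRing.Theory Num.Theory.
Import numFieldNormedType.Exports.
Local Open Scope classical_set_scope.
Local Open Scope ring_scope.

(** The crude estimate [ln 4 <= 2], from [ln 2 <= 1], is enough for the coefficient 1/3. *)
Lemma ln_trunc_log4_le (R : realType) k : (0 < k)%N ->
  ln (k%:R : R) <= 2 * (trunc_log 4 k).+1%:R.
Proof.
move=> k0; have k_lt : (k <= 4 ^ (trunc_log 4 k).+1)%N by rewrite ltnW // trunc_log_ltn.
have ln2 : ln (2 : R) <= 1 by have := @le_ln1Dx R 1; rewrite -[1 + 1]/(2%:R); apply.
apply: (@le_trans _ _ (ln ((4 ^ (trunc_log 4 k).+1)%N%:R : R))).
  by rewrite ler_ln ?posrE ?ltr0n ?expn_gt0 // ler_nat.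
by rewrite (_ : 4%N = 2 ^ 2)%N // -expnM natrX lnXn // -natrM lerMn2r ln2 orbT.
Qed.

Theorem theorem1p14 (R : realType) :
  exists (G : nat -> sgraph) (a b : nat -> R),
    [/\ a =o_\oo (fun k : nat => k%:R : R),
        b =o_\oo (fun _ : nat => 1 : R) &
        forall k : nat, (0 < k)%N ->
          [/\ bipartite (G k),
              (parity_number (G k))%:R <= 2 * k%:R + a k &
              (3^-1 - b k) * k%:R * ln k%:R
                <= (strong_parity_number (G k))%:R ]].
Proof.
(* With [S = gap_size k], the strong number is at least [(S - 3/2) k] and [ln k <= 2 (S + 1)], so
   1/3 works once [S - 3/2 >= 2 (S + 1) / 3], that is [S >= 13/2]. Hence the threshold [4 ^ 7],
   below which [b k = 1/3] makes the lower bound zero. *)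
exists gap_graph, (fun=> 0), (fun k => if (k < 4 ^ 7)%N then 3^-1 else 0).
split=> [||k k0].
- by apply/eqoP => e e0; near=> k; rewrite normr0 mulr_ge0 // ltW.
- apply/eqoP => e e0; near=> k; rewrite ltnNge (_ : (4 ^ 7 <= k)%N) /=.
    by rewrite normr0 mulr_ge0 // ltW.
  by near: k; apply: nbhs_infty_ge.
have [p_le sp_ge] := gap_graph_bounds k0.
split; first exact: hub_graph_bipartite.
  by rewrite addr0 -natrM ler_nat.
case: ltnP => [_|k_large]; first by rewrite subrr !mul0r.
rewrite subr0; have S7 : (7 <= gap_size k)%N by rewrite trunc_log_max.
have ln_le := @ln_trunc_log4_le R k k0; rewrite -/(gap_size k) -natr1 in ln_le.
move: sp_ge; rewrite -(ler_nat R) natrD !natrM => sp_ge.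
have {}S7 : 7 <= (gap_size k)%:R :> R by rewrite ler_nat.
have k_ge0 : 0 <= k%:R :> R by [].
nra.
Unshelve. all: by end_near.
Qed.
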